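(* Let $n, m$ be odd positive integers, and let $u$ and $v$ be the orders of $2$ in $(\mathbb{Z}/m\mathbb{Z})^{\times}$ and $(\mathbb{Z}/n\mathbb{Z})^{\times}$, respectively. If $\gcd(u,v)=1$, then the $2$-rank of the curve $\mathcal{F}: y^{m} = x^{n} + 1$ over $\overline{\mathbb{F}}_2$ is zero.
   Context: A ''curve'' given by an affine equation over $\overline{\mathbb{F}}_p$ means the nonsingular, projective, irreducible curve whose function field is defined by that equation. The $p$-rank of a curve $\mathcal{X}$ over $\overline{\mathbb{F}}_p$ with Jacobian $J$ is the integer $\gamma$ such that $J[p](\overline{\mathbb{F}}_p)\cong(\mathbb{Z}/p\mathbb{Z})^{\gamma}$; a curve of genus $0$ has $p$-rank $0$. Here $p=2$. *)

(* Defs.v *)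
From HB Require Import structures.
From mathcomp Require Import all_boot all_order all_algebra all_field.
From mathcomp Require Import ring_quotient generic_quotient.
From mathcomp Require Import boolp.
From mathcomp Require Import freeg.

Set Implicit Arguments.
Unset Strict Implicit.
Unset Printing Implicit Defensive.

Import GRing.Theory Num.Theory.

Local Open Scope ring_scope.
Local Open Scope quotient_scope.

(* The order of a in (Z/m)^*; stated with congruences because 'Z_1 is not the
   trivial ring in MathComp. For m = 1 the order is 1. *)
Definition unit_order (a m d : nat) : Prop :=
  [/\ (0 < d)%N, (a ^ d = 1 %[mod m])%N
    & forall e : nat, (0 < e)%N -> (a ^ e = 1 %[mod m])%N -> (d <= e)%N].

Section FunctionField.
Variables (k F : fieldType) (emb : {rmorphism k -> F}).

(* A bivariate polynomial is a polynomial in 'X with coefficients in k['Y], as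
   in polyXY; u.[x, y] substitutes x for 'X and y for 'Y. *)
Definition eval2 (P : {poly {poly k}}) (x y : F) : F :=
  (map_poly (map_poly emb) P).[x, y].

(* F = Frac (k['X, 'Y] / (P)), with x and y the classes of 'X and 'Y. *)
Definition function_field_of (P : {poly {poly k}}) (x y : F) : Prop :=
  (forall Q : {poly {poly k}}, eval2 Q x y = 0 <-> exists S, Q = S * P)
  /\ (forall z : F, exists Q1 Q2 : {poly {poly k}},
        eval2 Q2 x y != 0 /\ z = eval2 Q1 x y / eval2 Q2 x y).

(* The closed points of the nonsingular projective curve with function field F
   over an algebraically closed k: the normalized discrete valuations of F that
   are trivial on k. The value at 0 (which should be +oo) is set to 0 so that
   equal valuations are equal records. *)
Record place : Type := Place {
  ord :> F -> int;
  ord0 : ord 0 = 0;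
  ordM : forall f g : F, f != 0 -> g != 0 -> ord (f * g) = ord f + ord g;
  ordD : forall f g : F, f != 0 -> g != 0 -> f + g != 0 ->
    Num.min (ord f) (ord g) <= ord (f + g);
  ord_const : forall c : k, ord (emb c) = 0;
  ord_unif : exists t : F, ord t = 1
}.

HB.instance Definition _ := gen_eqMixin place.
HB.instance Definition _ := gen_choiceMixin place.

Definition divisor := {freeg place / int}.
HB.instance Definition _ := GRing.Zmodule.on divisor.

Definition is_div_of (D : divisor) (f : F) : Prop :=
  f != 0 /\ forall P : place, coeff P D = P f.

Definition principal : {pred divisor} :=
  fun D => `[< exists f : F, is_div_of D f >].

Lemma principal_zmod_closed : zmod_closed principal.
Proof.
split=> [|D E /asboolP[f [f0 Df]] /asboolP[g [g0 Eg]]]; apply/asboolP.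
  exists 1; split; first exact: oner_neq0.
  by move=> P; rewrite coeff0 -(rmorph1 emb) ord_const.
exists (f / g); split; first by rewrite mulf_neq0 ?invr_eq0.
move=> P; rewrite coeffB Df Eg ordM ?invr_eq0 //; congr (_ + _).
have := ord_const P 1; rewrite rmorph1 -(divff g0) ordM ?invr_eq0 //.
by move/eqP; rewrite addrC addr_eq0 => /eqP.
Qed.

HB.instance Definition _ :=
  GRing.isZmodClosed.Build divisor principal principal_zmod_closed.

Definition Pic : zmodType := {ideal_quot principal}.

(* J(k) = Pic^0: the classes of the divisors of degree 0. All residue fields
   are k since k is algebraically closed, so deg D is the sum of the
   coefficients. *)
Definition in_Jac (c : Pic) : Prop :=
  exists2 D : divisor, deg D = 0 & c = \pi_({ideal_quot principal}) D.

(* J[p](k) is isomorphic to (Z/pZ)^gamma. *)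
Definition has_prank (p gamma : nat) : Prop :=
  exists phi : {additive 'rV['F_p]_gamma -> Pic}, injective phi /\
    forall c : Pic, (in_Jac c /\ c *+ p = 0) <-> exists w, c = phi w.

End FunctionField.

(* Main.v *)
Require Import Defs.
From HB Require Import structures.
From mathcomp Require Import all_boot all_order all_algebra all_field.
From mathcomp Require Import ring_quotient generic_quotient boolp freeg.
From mathcomp Require Import zify ring.

(** A class of order two in the Jacobian is the class of a divisor D with
    2 D = div f, so f has even order at every place of F, and what has to be
    shown is that such an f is a square ([even_order_square]).

    As k is perfect, F = F^2 + F^2 y ([square_decomposition]).  Write
    f = al^2 + be^2 y.  The logarithmic differential df / f is g dy with
    g = be^2 / f, and it has two properties.

    - It has no pole on the affine curve.  At a place P with uniformizer t,
      write f = a^2 + b^2 t; the two terms have orders of different parity, so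
      when ord_P f is even it is at most ord_P (b^2 t), and b^2 / f is regular
      at P ([even_order_log_derivative]).  Changing variables from t to y, this
      says that h = g x^(n-1) is regular at P ([log_derivative_regular]).  A
      function regular at all affine points is a polynomial in x and y
      ([regular_is_polynomial]), so g is the sum over j < n of s_j(y) x^-j with
      polynomials s_j.

    - It is fixed by the Cartier operator, that is, g = (al be / f)^2 + y g^2.
      Comparing coefficients of powers of x and differentiating with respect
      to y gives s_j^2 = (w_j s_(2j mod n))', where w_j is 1 if 2j < n and
      y^m + 1 otherwise ([cartier_fixed_coefficients]).

    Let N be the set of the pairs (i, j) for which y^(i-1) x^-j occurs in g.
    By the second property, (i, j) in N implies (2i, 2j) in N if 2j < n, and
    (2i, 2j-n) or (2i-m, 2j-n) in N otherwise.  A positive weight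
    i/m - j/n would at least double at each of these steps, and N is finite, so
    i/m <= j/n on N.  Hence i < m and j > 0 on N, and N is stable under
    (i, j) |-> (2i mod m, 2j mod n).  Doubling has a period u on the first
    coordinate and v on the second; these are coprime, so by the Chinese
    remainder theorem the two coordinates can be doubled independently.  But i
    can be moved above m/2 and j below n/2, against i/m <= j/n.  So N is empty
    ([doubling_support_empty]), and then g = 0, be = 0 and f = al^2.

    The argument uses one place of F over each affine point (a, b).  These are
    obtained from the local ring at (a, b), where every nonzero function is a
    power of a uniformizer times a unit: the uniformizer is y - b if a != 0
    and x if a = 0 ([place_of_uniformizer], [place_unramified],
    [place_ramified]). *)

Set Implicit Arguments.
Unset Strict Implicit.
Unset Printing Implicit Defensive.

Import Order.TTheory GRing.Theory Num.Theory.
Local Open Scope ring_scope.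

(** * Doubling modulo two odd numbers *)

Lemma doubling_large (m i : nat) : odd m -> (0 < i < m)%N ->
  exists a, (m < 2 * ((2 ^ a * i) %% m))%N.
Proof.
move=> m_odd; move: {2}(m - i)%N (leqnn (m - i)) => e.
elim: e i => [|e IH] i le_e /andP[i_gt0 lt_im]; first lia.
have [lt_m2i|ge_m2i] := ltnP m (2 * i); first by exists 0%N; rewrite mul1n modn_small.
have [|//|a] := IH (2 * i)%N; [lia|apply/andP; split; lia|].
by exists a.+1; rewrite expnSr -mulnA.
Qed.

Lemma doubling_small (n j : nat) : odd n -> (0 < j < n)%N ->
  exists a, (2 * ((2 ^ a * j) %% n) < n)%N.
Proof.
move=> n_odd; move: {2}j (leqnn j) => e.
elim: e j => [|e IH] j le_e /andP[j_gt0 lt_jn]; first lia.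
have [lt_n2j|ge_n2j] := ltnP (2 * j) n; first by exists 0%N; rewrite mul1n modn_small.
have [|//|a] := IH (2 * j - n)%N; [lia|apply/andP; split; lia|].
exists a.+1; rewrite expnSr -mulnA.
by rewrite -(subnK ge_n2j) mulnDr addnC modnMDl.
Qed.

Lemma expn_mod_order (a m u e : nat) : (a ^ u = 1 %[mod m])%N ->
  (a ^ e = a ^ (e %% u) %[mod m])%N.
Proof.
move=> au1; rewrite {1}(divn_eq e u) expnD (mulnC (e %/ u)%N) expnM.
by rewrite -modnMml -modnXm au1 modnXm exp1n modnMml mul1n.
Qed.

(** The integer n i - m j is the weight i/m - j/n up to the factor m n.  If it
    is positive it at least doubles along the successors, which the bound B on
    the first coordinate forbids. *)
Lemma doubling_support_below (m n : nat) (N : nat -> nat -> Prop) (B : nat) :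
    (forall i j, N i j -> (0 < i <= B)%N && (j < n)%N) ->
    (forall i j, N i j ->
       if (2 * j < n)%N then N (2 * i)%N (2 * j)%N
       else N (2 * i)%N (2 * j - n)%N \/ N (2 * i - m)%N (2 * j - n)%N) ->
  forall i j, N i j -> (n * i <= m * j)%N.
Proof.
move=> N_range N_step i j.
move=> Nij; case: leqP => // lt_ji; exfalso.
  move: {2}(n * B - (n * i - m * j)).+1%N (leqnn (n * B - (n * i - m * j)).+1) => e.
  elim: e i j Nij lt_ji => [|e IH] i j Nij lt_ji //.
  have /andP[/andP[i_gt0 le_iB] lt_jn] := N_range _ _ Nij.
  have le_nB : (n * i <= n * B)%N by rewrite leq_mul.
  move=> le_e; have := N_step _ _ Nij; case: ltnP => [_ N2|ge_j].
    have /andP[/andP[_ le_iB2] _] := N_range _ _ N2.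
    have le_nB2 : (n * (2 * i) <= n * B)%N by rewrite leq_mul.
    apply: (IH _ _ N2); rewrite ?mulnBr; clear -le_e le_nB le_nB2 lt_ji ; lia.
  case=> N2; have /andP[/andP[i2_gt0 le_iB2] _] := N_range _ _ N2.
    have le_nB2 : (n * (2 * i) <= n * B)%N by rewrite leq_mul.
    have nm : (m * n <= m * (2 * j))%N by rewrite leq_mul.
    apply: (IH _ _ N2); rewrite ?mulnBr; clear -le_e le_nB le_nB2 lt_ji nm; lia.
  have nm : (m * n <= m * (2 * j))%N by rewrite leq_mul.
  have nm' : (n * m <= n * (2 * i))%N by rewrite leq_mul //; lia.
  have le_nB2 : (n * (2 * i - m) <= n * B)%N by rewrite leq_mul.
  rewrite mulnBr in le_nB2; apply: (IH _ _ N2); rewrite ?mulnBr;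
    clear -le_e le_nB le_nB2 lt_ji nm nm'; lia.
Qed.

(** Below the line i/m = j/n the only possible successor of (i, j) is
    (2i mod m, 2j mod n).  Since the periods u and v are coprime, some power of
    two acts on i as the one that brings it above m/2, and on j as the one that
    brings it below n/2. *)
Lemma doubling_support_empty (m n u v : nat) (N : nat -> nat -> Prop) (B : nat) :
    odd m -> odd n -> unit_order 2 m u -> unit_order 2 n v -> gcdn u v = 1%N ->
    (forall i j, N i j -> (0 < i <= B)%N && (j < n)%N) ->
    (forall i j, N i j ->
       if (2 * j < n)%N then N (2 * i)%N (2 * j)%N
       else N (2 * i)%N (2 * j - n)%N \/ N (2 * i - m)%N (2 * j - n)%N) ->
  forall i j, ~ N i j.
Proof.
move=> m_odd n_odd u_ord v_ord uv1 N_range N_step.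
have below := doubling_support_below N_range N_step.
have lt_im i j : N i j -> (0 < i < m)%N && (0 < j < n)%N.
  move=> Nij; have := below _ _ Nij; have /andP[/andP[i_gt0 _] lt_jn] := N_range _ _ Nij.
  by move=> le_ij; apply/andP; split; apply/andP; split; nia.
have double i j : N i j -> N ((2 * i) %% m)%N ((2 * j) %% n)%N.
  move=> Nij; have /andP[/andP[i_gt0 lt_i] /andP[j_gt0 lt_j]] := lt_im _ _ Nij.
  have := N_step _ _ Nij; case: ltnP => [lt_2j N2|ge_j].
    have /andP[/andP[_ lt_2i] _] := lt_im _ _ N2.
    by rewrite !modn_small.
  rewrite -[X in N _ (X %% n)%N](subnK ge_j) modnDr (@modn_small (2 * j - n)); last lia.
  case=> N2; have /andP[/andP[gt0_2i lt_2i] _] := lt_im _ _ N2.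
    by rewrite modn_small.
  have ge_i : (m <= 2 * i)%N by lia.
  by rewrite -[X in N (X %% m)%N _](subnK ge_i) modnDr (@modn_small (2 * i - m)).
have iter_double i j a : N i j -> N ((2 ^ a * i) %% m)%N ((2 ^ a * j) %% n)%N.
  move=> Nij; have /andP[/andP[i_gt0 lt_i] /andP[j_gt0 lt_j]] := lt_im _ _ Nij.
  elim: a => [|a IH]; first by rewrite !mul1n !modn_small.
  by have := double _ _ IH; rewrite !modnMmr !mulnA -!expnS.
move=> i j Nij; have /andP[ir jr] := lt_im _ _ Nij.
have [a lt_a] := doubling_large m_odd ir.
have [b lt_b] := doubling_small n_odd jr.
have [[_ m2u _] [_ n2v _]] := (u_ord, v_ord).
have uv : coprime u v by rewrite /coprime uv1.
pose c := chinese u v a b.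
have := below _ _ (iter_double _ _ c Nij).
rewrite -modnMml (expn_mod_order c m2u) /c chinese_modl //.
rewrite -(expn_mod_order a m2u) modnMml.
rewrite -[X in (_ <= m * X)%N]modnMml (expn_mod_order _ n2v) chinese_modr //.
rewrite -(expn_mod_order b n2v) modnMml.
clear -lt_a lt_b; nia.
Qed.

(** * Places from local rings *)

(** Here A is a coordinate ring with its evaluation [ev] in the function field
    and its evaluation [vl] at a point. *)
Section LocalRing.
Variables (k F : fieldType) (emb : {rmorphism k -> F}) (A : comNzRingType).
Variables (ev : {rmorphism A -> F}) (vl : {rmorphism A -> k}) (cst : k -> A).
Hypothesis ev_cst : forall c, ev (cst c) = emb c.
Hypothesis vl_cst : forall c, vl (cst c) = c.
Hypothesis vl_eq0 : forall Q, ev Q = 0 -> vl Q = 0.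

(** The function f is regular at the point, with value c there.  A relation
    keeps the partial evaluation map free of choices. *)
Definition takes (f : F) (c : k) : Prop :=
  exists Q1 Q2, [/\ vl Q2 != 0, f * ev Q2 = ev Q1 & c * vl Q2 = vl Q1].

Lemma ev_neq0 Q : vl Q != 0 -> ev Q != 0.
Proof. by apply: contra_neq; exact: vl_eq0. Qed.

Lemma takes_ev Q : takes (ev Q) (vl Q).
Proof. by exists Q, 1; rewrite !rmorph1 !mulr1 oner_eq0. Qed.

Lemma takes_const c : takes (emb c) c.
Proof. by have := takes_ev (cst c); rewrite ev_cst vl_cst. Qed.

Lemma takes0 : takes 0 0.
Proof. by have := takes_ev 0; rewrite !rmorph0. Qed.

Lemma takes1 : takes 1 1.
Proof. by have := takes_ev 1; rewrite !rmorph1. Qed.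

Lemma takesD f g c d : takes f c -> takes g d -> takes (f + g) (c + d).
Proof.
move=> [P1 [P2 [P2_0 fP cP]]] [Q1 [Q2 [Q2_0 gQ dQ]]].
exists (P1 * Q2 + Q1 * P2), (P2 * Q2).
rewrite !rmorphD !rmorphM mulf_neq0 // -fP -gQ -cP -dQ; split=> //; ring.
Qed.

Lemma takesM f g c d : takes f c -> takes g d -> takes (f * g) (c * d).
Proof.
move=> [P1 [P2 [P2_0 fP cP]]] [Q1 [Q2 [Q2_0 gQ dQ]]].
exists (P1 * Q1), (P2 * Q2).
rewrite !rmorphM mulf_neq0 // -fP -gQ -cP -dQ; split=> //; ring.
Qed.

Lemma takesX f c i : takes f c -> takes (f ^+ i) (c ^+ i).
Proof.
move=> fc; elim: i => [|i IH]; first exact: takes1.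
by rewrite !exprS; exact: takesM.
Qed.

Lemma takesV f c : c != 0 -> takes f c -> takes f^-1 c^-1.
Proof.
move=> c0 [P1 [P2 [P2_0 fP cP]]].
have P1_0 : vl P1 != 0 by rewrite -cP mulf_neq0.
have f0 : f != 0.
  by apply: contraNneq (ev_neq0 P1_0) => f0; rewrite -fP f0 mul0r.
by exists P2, P1; split=> //; rewrite -?fP -?cP mulKf.
Qed.

Lemma takes_inj f c d : takes f c -> takes f d -> c = d.
Proof.
move=> [P1 [P2 [P2_0 fP cP]]] [Q1 [Q2 [Q2_0 gQ dQ]]].
have /vl_eq0 : ev (P1 * Q2 - Q1 * P2) = 0.
  by rewrite rmorphB !rmorphM -fP -gQ; ring.
rewrite rmorphB !rmorphM -cP -dQ => e0.
apply: (mulIf (mulf_neq0 P2_0 Q2_0)); apply/eqP.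
by rewrite -subr_eq0; apply/eqP; rewrite -[RHS]e0; ring.
Qed.

Variable t : F.
Hypothesis t_neq0 : t != 0.
Hypothesis t_0 : takes t 0.
Hypothesis t_unif : forall Q, ev Q != 0 ->
  exists N w c, [/\ ev Q = t ^+ N * w, takes w c & c != 0].
Hypothesis ev_frac : forall f, exists Q1 Q2, ev Q2 != 0 /\ f = ev Q1 / ev Q2.

(** A function regular at the point with nonzero value is a unit of the local
    ring. *)
Definition order_at (f : F) (z : int) : Prop :=
  exists w c, [/\ f = t ^ z * w, takes w c & c != 0].

Lemma takes_neq0 w c : takes w c -> c != 0 -> w != 0.
Proof.
move=> wc; apply: contra_neq => w0; apply: takes_inj wc _.
by rewrite w0; exact: takes0.
Qed.

Lemma order_exists f : f != 0 -> exists z, order_at f z.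
Proof.
have [Q1 [Q2 [Q2_0 ->]]] := ev_frac f.
rewrite mulf_eq0 negb_or invr_eq0 Q2_0 andbT => Q1_0.
have [N [w [c [-> wc c0]]]] := t_unif Q1_0.
have [M [w' [c' [-> wc' c'0]]]] := t_unif Q2_0.
exists (N%:Z - M%:Z), (w / w'), (c / c'); split.
- by rewrite expfzDr // -exprnN invfM -!exprnP mulrACA.
- by apply: takesM => //; exact: takesV.
- by rewrite mulf_neq0 ?invr_eq0.
Qed.

Lemma orderM f g z1 z2 : order_at f z1 -> order_at g z2 -> order_at (f * g) (z1 + z2).
Proof.
move=> [w [c [-> wc c0]]] [w' [c' [-> wc' c'0]]].
exists (w * w'), (c * c'); split; last by rewrite mulf_neq0.
- by rewrite expfzDr // mulrACA.
- exact: takesM.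
Qed.

Lemma orderV f z : order_at f z -> order_at f^-1 (- z).
Proof.
move=> [w [c [-> wc c0]]]; exists w^-1, c^-1; split; last by rewrite invr_eq0.
- by rewrite -invr_expz invfM.
- exact: takesV.
Qed.

Lemma takes_tn (n : nat) : (0 < n)%N -> takes (t ^+ n) 0.
Proof. by case: n => // n _; have := takesX n.+1 t_0; rewrite expr0n. Qed.

Lemma order_ge0 f c z : takes f c -> order_at f z -> 0 <= z.
Proof.
move=> fc [w [d [fE wd d0]]]; rewrite leNgt; apply/negP => z_lt0.
have z_n : z = - (absz z)%:Z by lia.
case/eqP: d0; apply: (takes_inj wd).
have -> : w = t ^+ absz z * f.
  rewrite fE {2}z_n -invr_expz mulrA -exprnP mulfV ?mul1r //.
  exact: expf_neq0.
by rewrite -(mul0r c); apply: takesM => //; apply: takes_tn; lia.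
Qed.

Lemma order_inj f z1 z2 : order_at f z1 -> order_at f z2 -> z1 = z2.
Proof.
have le z z' : order_at f z -> order_at f z' -> z <= z'.
  move=> fz fz'; have f0 : f != 0.
    have [w [c [-> wc c0]]] := fz.
    by rewrite mulf_neq0 ?expfz_neq0 // (takes_neq0 wc).
  rewrite -subr_ge0; apply: (@order_ge0 1 1); first exact: takes1.
  by rewrite -(divff f0); apply: orderM => //; exact: orderV.
by move=> fz1 fz2; apply/eqP; rewrite eq_le !le.
Qed.

Lemma order_takes f z : order_at f z -> 0 <= z -> exists c, takes f c.
Proof.
case: z => // n [w [c [-> wc _]]] _.
by exists (0 ^+ n * c); apply: takesM => //; rewrite -exprnP; apply: takesX.
Qed.

(** After division by t^z1 both terms are regular, hence so is the sum. *)
Lemma orderD f g z1 z2 z : order_at f z1 -> order_at g z2 -> order_at (f + g) z ->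
  Num.min z1 z2 <= z.
Proof.
wlog le12 : f g z1 z2 / z1 <= z2.
  move=> IH f1 g2 fg; have /orP[le12|le21] := le_total z1 z2.
    exact: IH le12 f1 g2 fg.
  by rewrite minC; apply: (IH g f) => //; rewrite addrC.
move=> f1 g2 fg; rewrite min_l // -subr_ge0.
have t1 : order_at (t ^ z1) z1.
  by exists 1, 1; rewrite mulr1 oner_eq0; split=> //; exact: takes1.
have t0 : t ^ z1 != 0 by rewrite expfz_neq0.
have sh h y : order_at h y -> order_at (h / t ^ z1) (y - z1).
  by move=> hy; apply: orderM => //; exact: orderV.
have [c fc] : exists c, takes (f / t ^ z1) c.
  by apply: (order_takes (sh _ _ f1)); rewrite subrr.
have [d gd] : exists d, takes (g / t ^ z1) d.
  by apply: (order_takes (sh _ _ g2)); rewrite subr_ge0.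
apply: (@order_ge0 _ (c + d)) (sh _ _ fg); rewrite mulrDl; exact: takesD.
Qed.

Lemma place_of_uniformizer : exists P : place emb,
  P t = 1 /\ forall f, 0 <= P f -> f != 0 -> exists c, takes f c.
Proof.
pose o f : int :=
  if pselect (f != 0) is left f0 then projT1 (cid (order_exists f0)) else 0.
have oP f : f != 0 -> order_at f (o f).
  by rewrite /o; case: pselect => // f0 _; case: cid.
have oE f z : order_at f z -> o f = z.
  move=> fz; apply: order_inj (fz); apply: oP.
  have [w [c [-> wc c0]]] := fz.
  by rewrite mulf_neq0 ?expfz_neq0 // (takes_neq0 wc).
have o0 : o 0 = 0 by rewrite /o; case: pselect => // e; exfalso; move: e; rewrite eqxx.
have oM f g : f != 0 -> g != 0 -> o (f * g) = o f + o g.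
  by move=> f0 g0; apply/oE/orderM; apply: oP.
have oD f g : f != 0 -> g != 0 -> f + g != 0 -> Num.min (o f) (o g) <= o (f + g).
  by move=> f0 g0 fg0; apply: (@orderD f g); apply: oP.
have oC c : o (emb c) = 0.
  have [->|c0] := eqVneq c 0; first by rewrite rmorph0.
  apply/oE; exists (emb c), c; split=> //; first by rewrite mul1r.
  exact: takes_const.
have ot : o t = 1.
  by apply: oE; exists 1, 1; rewrite mulr1 oner_eq0; split=> //; exact: takes1.
exists (Place o0 oM oD oC (ex_intro _ t ot)); split=> // f f_ge0 f0.
exact: order_takes (oP _ f0) f_ge0.
Qed.

End LocalRing.

Section Place.
Variables (k F : fieldType) (emb : {rmorphism k -> F}) (P : place emb).
Hypothesis char2 : 2 \in [pchar F].

Lemma ordX2 f : f != 0 -> P (f ^+ 2) = P f + P f.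
Proof. by move=> f0; rewrite expr2 ordM. Qed.

Lemma ordV f : f != 0 -> P f^-1 = - P f.
Proof.
move=> f0; apply/eqP; rewrite -addr_eq0 addrC -ordM ?invr_eq0 // divff //.
by rewrite -(rmorph1 emb) ord_const.
Qed.

(** The orders of a^2 and of b^2 t have different parities, so P f is the
    smaller of the two; being even, it is at most P (b^2 t) - 1 = P (b^2). *)
Lemma even_order_log_derivative (f a b t : F) (e : int) :
  f != 0 -> f = a ^+ 2 + b ^+ 2 * t -> P t = 1 -> P f = e + e ->
  0 <= P (b ^+ 2 / f).
Proof.
move=> f0 fE Pt Pf; have [->|b0] := eqVneq b 0.
  by rewrite expr0n mul0r Defs.ord0.
have t0 : t != 0 by apply: contra_eq_neq Pt => ->; rewrite Defs.ord0.
have bt0 : b ^+ 2 * t != 0 by rewrite mulf_neq0 ?expf_neq0.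
have Pbt : P (b ^+ 2 * t) = P b + P b + 1 by rewrite ordM ?expf_neq0 // ordX2 // Pt.
rewrite ordM ?expf_neq0 ?invr_eq0 // ordX2 // ordV //.
have [a0|a0] := eqVneq a 0.
  by move: Pf; rewrite fE a0 expr0n add0r Pbt; lia.
have a20 : a ^+ 2 != 0 by rewrite expf_neq0.
have D1 : a ^+ 2 + b ^+ 2 * t != 0 by rewrite -fE.
have E2 : f + a ^+ 2 = b ^+ 2 * t.
  by rewrite fE addrC addrA addrr_pchar2 // add0r.
have E3 : f + b ^+ 2 * t = a ^+ 2.
  by rewrite fE -addrA addrr_pchar2 // addr0.
have := ordD P a20 bt0 D1; rewrite -fE Pbt ordX2 //.
have := ordD P f0 a20; rewrite E2 => /(_ bt0); rewrite Pbt ordX2 //.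
have := ordD P f0 bt0; rewrite E3 => /(_ a20); rewrite Pbt ordX2 // Pf.
by rewrite /Order.min; do 3 case: ifP; lia.
Qed.
End Place.

(** * Characteristic two and doubling *)

Lemma mulrn_odd_pchar2 (R : nzRingType) (c : R) (N : nat) :
  2 \in [pchar R] -> odd N -> c *+ N = c.
Proof.
move=> c2 N_odd; rewrite -(odd_double_half N) N_odd add1n mulrS -muln2 mulrnA.
by rewrite mulrn_pchar // addr0.
Qed.

Lemma sqr_sum_pchar2 (R : comNzRingType) (I : Type) (r : seq I) (f : I -> R) :
  2 \in [pchar R] -> (\sum_(i <- r) f i) ^+ 2 = \sum_(i <- r) f i ^+ 2.
Proof. by move=> c2; rewrite -!(pFrobenius_autE c2) rmorph_sum. Qed.

(** Frobenius: the square of a sum of monomials is the sum of their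
    squares. *)
Lemma coef_sqr_pchar2 (R : comNzRingType) (p : {poly R}) i :
  2 \in [pchar R] -> (p ^+ 2)`_(i.*2) = p`_i ^+ 2.
Proof.
move=> c2; have c2p : 2 \in [pchar {poly R}] by rewrite pchar_poly.
rewrite -{1}(coefK p) poly_def sqr_sum_pchar2 // coef_sum.
have [lt_i|ge_i] := ltnP i (size p); last first.
  rewrite (nth_default 0 ge_i) expr0n big1 // => j _.
  rewrite exprZn -exprM coefZ coefXn muln2 (inj_eq double_inj) [_ == _]gtn_eqF ?mulr0 //.
  exact: leq_trans ge_i.
rewrite (bigD1 (Ordinal lt_i)) //= big1 ?addr0 => [|j ne_j].
  by rewrite exprZn -exprM coefZ coefXn muln2 eqxx mulr1.
rewrite exprZn -exprM coefZ coefXn muln2 (inj_eq double_inj).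
by rewrite -val_eqE eq_sym /= in ne_j; rewrite (negPf ne_j) mulr0.
Qed.

Lemma deriv_sqr_pchar2 (R : comNzRingType) (p : {poly R}) :
  2 \in [pchar R] -> (p ^+ 2)^`() = 0.
Proof.
move=> c2; have c2p : 2 \in [pchar {poly R}] by rewrite pchar_poly.
by rewrite expr2 derivM mulrC addrr_pchar2.
Qed.

Definition dbl_ord n (n_gt0 : (0 < n)%N) (j : 'I_n) : 'I_n :=
  Ordinal (ltn_pmod (2 * j) n_gt0).

(** The inverse is multiplication by (n+1)/2. *)
Lemma dbl_ord_bij n (n_gt0 : (0 < n)%N) : odd n -> bijective (@dbl_ord n n_gt0).
Proof.
move=> n_odd; apply: injF_bij.
pose g (l : 'I_n) : 'I_n := Ordinal (ltn_pmod (n.+1./2 * l) n_gt0).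
apply: (@can_inj _ _ _ g) => i.
apply/val_inj; rewrite /= modnMmr mulnA muln2.
have -> : (n.+1./2).*2 = n.+1 by rewrite -[RHS]odd_double_half /= n_odd.
by rewrite mulSn addnC [(n * i)%N]mulnC modnMDl modn_small.
Qed.

Lemma expr_odd (R : nzRingType) (z : R) N : odd N -> z ^+ N = z * (z ^+ N./2) ^+ 2.
Proof.
by move=> N_odd; rewrite -exprM muln2 -exprS -[in LHS](odd_double_half N) N_odd.
Qed.

Lemma closed_sqrt (k : closedFieldType) (c : k) : exists r, r ^+ 2 = c.
Proof.
have [r] := @solve_monicpoly k 2 (nth 0 [:: c]) isT.
rewrite !big_ord_recl big_ord0 /= expr0 mulr1 mul0r !addr0 => rE.
by exists r.
Qed.

(** * The curve x^n = y^m + 1 in characteristic two *)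

Section Curve.
Variables (k : closedFieldType) (F : fieldType) (emb : {rmorphism k -> F}).
Variables (x y : F) (n m : nat).
Hypotheses (n_odd : odd n) (m_odd : odd m) (char2 : 2 \in [pchar k]).
Hypothesis F_curve : function_field_of emb ('Y ^+ m - ('X ^+ n + 1)) x y.

Implicit Types (Q S : {poly {poly k}}) (D : {poly k}).

Let n_gt0 : (0 < n)%N := odd_gt0 n_odd.
Let m_gt0 : (0 < m)%N := odd_gt0 m_odd.

Definition ev Q : F := eval2 emb Q x y.
HB.instance Definition _ := GRing.RMorphism.copy ev
  (horner_eval y \o horner_eval x%:P \o map_poly (map_poly emb)).

Definition val_at (a b : k) Q : k := Q.[a, b].
HB.instance Definition _ a b := GRing.RMorphism.copy (val_at a b)
  (horner_eval b \o horner_eval a%:P).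

Let Fchar2 : 2 \in [pchar F].
Proof. by rewrite (fmorph_pchar emb). Qed.

Lemma evX : ev 'X = x.
Proof. by rewrite /ev /eval2 map_polyX hornerX hornerC. Qed.

Lemma evY (p : {poly k}) : ev p%:P = (map_poly emb p).[y].
Proof. by rewrite /ev /eval2 map_polyC /= hornerC. Qed.

Lemma evC c : ev c%:P%:P = emb c.
Proof. by rewrite evY map_polyC hornerC. Qed.

Lemma val_atX a b : val_at a b 'X = a.
Proof. by rewrite /val_at hornerX hornerC. Qed.

Lemma val_atY a b (p : {poly k}) : val_at a b p%:P = p.[b].
Proof. by rewrite /val_at hornerC. Qed.

Lemma val_atC a b c : val_at a b c%:P%:P = c.
Proof. by rewrite val_atY hornerC. Qed.


(** The equation of the curve, up to sign, made monic in 'X: the functions of y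
    serve as coefficients and x is algebraic over them. *)
Definition curve_poly : {poly {poly k}} := 'X^n - ('X^m - 1)%:P.

Lemma ev_eq0 Q : ev Q = 0 <-> exists S, Q = S * curve_poly.
Proof.
have [kerP _] := F_curve.
have PE : curve_poly = - ('Y ^+ m - ('X ^+ n + 1)).
  by rewrite /curve_poly polyCB polyC_exp; ring.
split=> [/kerP[S ->]|[S ->]]; first by exists (- S); rewrite PE mulrNN.
by apply/kerP; exists (- S); rewrite PE mulrN mulNr.
Qed.

Lemma curve_eq : x ^+ n = y ^+ m + 1.
Proof.
have /ev_eq0 : exists S, curve_poly = S * curve_poly by exists 1; rewrite mul1r.
rewrite /curve_poly rmorphB rmorphXn /= evX evY.
rewrite rmorphB rmorphXn rmorph1 /= map_polyX !hornerE.
by move=> /eqP; rewrite subr_eq0 => /eqP ->; rewrite (oppr_pchar2 Fchar2).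
Qed.

Lemma size_curve_poly : size curve_poly = n.+1.
Proof. by rewrite size_XnsubC. Qed.

Lemma ev_inj Q : (size Q <= n)%N -> ev Q = 0 -> Q = 0.
Proof.
move=> leQ /ev_eq0[S QE]; apply/eqP; apply: contraTT leQ => Q0.
rewrite -ltnNge QE.
have S0 : S != 0 by apply: contraNneq Q0 => S0; rewrite QE S0 mul0r.
have P0 : curve_poly != 0 by rewrite -size_poly_eq0 size_curve_poly.
rewrite size_mul // size_curve_poly addnS /= -[X in (X < _)%N]add0n ltn_add2r.
by rewrite size_poly_gt0.
Qed.

Lemma ev_reduce Q : exists2 R : {poly {poly k}}, (size R <= n)%N & ev R = ev Q.
Proof.
have monP : curve_poly \is monic by rewrite monicXnsubC.
exists (Pdiv.Ring.rmodp Q curve_poly).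
  by rewrite -ltnS -size_curve_poly Pdiv.Ring.ltn_rmodpN0 // monic_neq0.
rewrite [in RHS](Pdiv.RingMonic.rdivp_eq monP Q) rmorphD rmorphM /=.
have -> : ev curve_poly = 0 by apply/ev_eq0; exists 1; rewrite mul1r.
by rewrite mulr0 add0r.
Qed.

(** Reduce Q modulo the equation to degree less than n in x, and take for D the
    resultant of the equation and Q.  It is nonzero: a common factor would split
    the equation into two factors of degree less than n, and one of them would
    vanish in F, against [ev_inj]. *)
Lemma ev_inverse Q : ev Q != 0 ->
  exists V (D : {poly k}), D != 0 /\ ev V * ev Q = ev D%:P.
Proof.
have [R le_R <-] := ev_reduce Q => R_nz.
have R0 : R != 0 by apply: contraNneq R_nz => ->; rewrite rmorph0.
have [le1R|lt1R] := leqP (size R) 1.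
  exists 1, R`_0; rewrite rmorph1 mul1r -(size1_polyC le1R); split=> //.
  by rewrite -polyC_eq0 -size1_polyC.
have lt1P : (1 < size curve_poly)%N by rewrite size_curve_poly ltnS.
have [[U V] /= _ resE] := resultant_in_ideal lt1P lt1R.
exists V, (resultant curve_poly R); split; last first.
  rewrite resE rmorphD !rmorphM /=.
  have -> : ev curve_poly = 0 by apply/ev_eq0; exists 1; rewrite mul1r.
  by rewrite mulr0 add0r.
rewrite resultant_eq0 -leqNgt leqNgt; apply/negP => lt1G.
set G := gcdp _ _ in lt1G.
have /Pdiv.Idomain.dvdpP[[c H] /= c0 GH] : G %| curve_poly by exact: dvdp_gcdl.
have le_GR : (size G <= size R)%N by apply: dvdp_leq => //; exact: dvdp_gcdr.
have sGH : size (H * G) = n.+1 by rewrite -GH size_scale // size_curve_poly.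
have HG0 : H * G != 0 by rewrite -size_poly_eq0 sGH.
have [H0 G0] : H != 0 /\ G != 0 by apply/andP; rewrite -negb_or -mulf_eq0.
have /eqP : ev (H * G) = 0.
  by apply/ev_eq0; exists c%:P; rewrite -GH mul_polyC.
rewrite rmorphM /= mulf_eq0 => /orP[]/eqP /ev_inj e.
  case/eqP: (H0); apply: e; move: sGH; rewrite size_mul //; move: lt1G; clear.
  by move: (size G) (size H) => g h; lia.
by case/eqP: (G0); apply: e; exact: leq_trans le_GR le_R.
Qed.

Lemma ev_fraction f : exists (Q : {poly {poly k}}) (D : {poly k}),
  [/\ D != 0, (size Q <= n)%N & f * ev D%:P = ev Q].
Proof.
have [_ /(_ f)[Q1 [Q2 [Q2_0 ->]]]] := F_curve.
rewrite -/(ev Q1) -/(ev Q2).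
have [V [D [D0 VD]]] := @ev_inverse Q2 Q2_0.
have [R le_R RE] := ev_reduce (Q1 * V).
exists R, D; split=> //; rewrite RE rmorphM /= -VD mulrA (mulrAC (_ / _)) divfK //.
Qed.


Lemma y_neq0 : y != 0.
Proof.
apply/eqP=> y0; have : ('X%:P : {poly {poly k}}) = 0.
  by apply: ev_inj; rewrite ?evY ?map_polyX ?hornerX // (leq_trans (size_polyC_leq1 _)).
by apply/eqP; rewrite polyC_eq0 polyX_eq0.
Qed.

Lemma x_neq0 : x != 0.
Proof.
apply/eqP=> x0; have : (('X^m - (-1)%:P)%:P : {poly {poly k}}) = 0.
  apply: ev_inj; first by rewrite (leq_trans (size_polyC_leq1 _)).
  rewrite evY rmorphB rmorphXn /= map_polyX map_polyC !hornerE /= rmorphN1 opprK -curve_eq x0.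
  by rewrite expr0n gtn_eqF.
by apply/eqP; rewrite polyC_eq0 -size_poly_eq0 size_XnsubC.
Qed.

Section Point.
Variables (a b : k).
Hypothesis ab : a ^+ n = b ^+ m + 1.
Local Notation reg := (takes ev (val_at a b)).

Lemma val_at_eq0 Q : ev Q = 0 -> val_at a b Q = 0.
Proof.
move=> /ev_eq0[S ->]; rewrite rmorphM /= /curve_poly rmorphB rmorphXn /= val_atX val_atY.
rewrite !hornerE ab; have -> : b ^+ m + 1 - (b ^+ m - 1) = 1 + 1 by ring.
by rewrite addrr_pchar2 // mulr0.
Qed.

Lemma reg_ev Q : reg (ev Q) (val_at a b Q).
Proof. exact: takes_ev. Qed.

Lemma regC c : reg (emb c) c.
Proof. exact: (takes_const evC (val_atC a b)). Qed.

Lemma reg_x : reg x a.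
Proof. by have := reg_ev 'X; rewrite evX val_atX. Qed.

Lemma reg_y : reg y b.
Proof. by have := reg_ev 'X%:P; rewrite evY val_atY map_polyX !hornerX. Qed.

(** This cofactor of f - c in f^N - c^N takes the value N c^(N-1), and N is odd
    in characteristic two. *)
Lemma reg_geometric N f c : odd N -> reg f c ->
  reg (\sum_(i < N) f ^+ (N.-1 - i) * emb c ^+ i) (c ^+ N.-1).
Proof.
move=> N_odd fc.
have -> : c ^+ N.-1 = \sum_(i < N) c ^+ (N.-1 - i) * c ^+ i.
  rewrite -[LHS](mulrn_odd_pchar2 _ char2 N_odd) -[X in _ *+ X](card_ord N) -sumr_const.
  by apply: eq_bigr => i _; rewrite -exprD subnK // -ltnS prednK ?odd_gt0.
elim/big_ind2: _ => [|f1 c1 f2 c2|i _].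
- exact: takes0.
- exact: takesD.
- by apply: takesM; apply: takesX => //; exact: regC.
Qed.

Lemma vanish_at_point Q : val_at a b Q = 0 ->
  exists A B, Q = A * ('X - a%:P%:P) + B * ('X - b%:P)%:P.
Proof.
move=> Qab; have /factor_theorem[B BE] : root Q.[a%:P] b by apply/eqP.
have /factor_theorem[A AE] : root (Q - Q.[a%:P]%:P) a%:P.
  by rewrite /root !hornerE subrr.
by exists A, B%:P; rewrite -AE -polyCM -BE subrK.
Qed.

Lemma ev_XsubC : ev ('X - a%:P%:P) = x - emb a.
Proof. by rewrite rmorphB /= evX evC. Qed.

Lemma ev_YsubC : ev ('X - b%:P)%:P = y - emb b.
Proof. by rewrite evY rmorphB /= map_polyX map_polyC !hornerE. Qed.

Lemma ev_YsubC_neq0 : y - emb b != 0.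
Proof.
rewrite -ev_YsubC; apply/eqP => /ev_inj e.
have /eqP := e (leq_trans (size_polyC_leq1 _) n_gt0).
by rewrite polyC_eq0 polyXsubC_eq0.
Qed.

(** A function t is a uniformizer at (a, b) as soon as it divides x - a and
    y - b, the latter with a quotient that is a unit times a power of t; this
    last condition bounds the order of a function of y. *)
Section Uniformizer.
Variables (t w : F) (e : nat) (c d : k).
Hypotheses (t_neq0 : t != 0) (t_0 : reg t 0).
Hypotheses (yE : y - emb b = t ^+ e.+1 * w) (wc : reg w c) (c0 : c != 0).
Hypothesis xt : reg ((x - emb a) / t) d.

Lemma div_uniformizer f : reg f 0 -> exists c', reg (f / t) c'.
Proof.
move=> [Q1 [Q2 [Q2_0 fQ]]]; rewrite mul0r => /esym/vanish_at_point[A [B QE]].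
have Q2_nz := ev_neq0 val_at_eq0 Q2_0.
have fE : f / t = (ev A * ((x - emb a) / t) + ev B * (t ^+ e * w)) * (ev Q2)^-1.
  apply: (mulIf Q2_nz); rewrite mulfVK // mulrAC fQ QE rmorphD !rmorphM /=.
  rewrite ev_XsubC ev_YsubC yE exprS; field.
  exact: t_neq0.
rewrite fE; eexists; apply: takesM.
  apply: takesD; apply: takesM; [exact: reg_ev|exact: xt|exact: reg_ev|].
  by apply: takesM wc; apply: takesX t_0.
by apply: (takesV val_at_eq0 Q2_0); exact: reg_ev.
Qed.

(** Dividing by t as long as the value is zero. *)
Lemma uniformizer_power M f c' : reg f c' ->
  (exists N v c2, [/\ f = t ^+ N * v, reg v c2 & c2 != 0])
  \/ exists c2, reg (f / t ^+ M) c2.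
Proof.
elim: M f c' => [|M IH] f c' fc; first by right; exists c'; rewrite expr0 divr1.
have [c'0|c'0] := eqVneq c' 0; last by left; exists 0%N, f, c'; rewrite mul1r.
rewrite c'0 in fc; have [c3 fc3] := div_uniformizer fc.
have [[N [v [c2 [fE vc2 c20]]]]|[c2 fc2]] := IH _ _ fc3.
  by left; exists N.+1, v, c2; split=> //; rewrite exprS -mulrA -fE mulrC divfK.
by right; exists c2; rewrite exprS invfM mulrA.
Qed.

(** The division stops, because Q divides a nonzero polynomial D(y), whose order
    is that of a power of y - b. *)
Lemma uniformizer_order Q : ev Q != 0 ->
  exists N v c2, [/\ ev Q = t ^+ N * v, reg v c2 & c2 != 0].
Proof.
move=> Q0; have [V [D [D0 VD]]] := ev_inverse Q0.
have [s [D1]] := multiplicity_XsubC D b; rewrite D0 /= => D1b DE.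
have [//|[c2 Qc2]] := uniformizer_power (e.+1 * s).+1 (reg_ev Q).
have := takesM t_0 (takesM (reg_ev V) Qc2); rewrite mul0r.
have -> : t * (ev V * (ev Q / t ^+ (e.+1 * s).+1)) = w ^+ s * ev D1%:P.
  transitivity (ev V * ev Q * (t / t ^+ (e.+1 * s).+1)); first ring.
  rewrite VD DE polyCM polyC_exp rmorphM rmorphXn /= ev_YsubC yE.
  rewrite exprMn -exprM exprS; field.
  by rewrite t_neq0 expf_neq0.
move=> /(takes_inj val_at_eq0)/(_ (takesM (takesX s wc) (reg_ev _))) /eqP.
rewrite eq_sym mulf_eq0 expf_eq0 (negPf c0) andbF /= val_atY => D1b0.
by rewrite /root D1b0 in D1b.
Qed.

Lemma place_at_uniformizer : exists P : place emb,
  P t = 1 /\ forall f, 0 <= P f -> f != 0 -> exists c, reg f c.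
Proof.
apply: (place_of_uniformizer evC (val_atC a b) val_at_eq0 t_neq0 t_0).
  exact: uniformizer_order.
move=> f; have [_ /(_ f)[Q1 [Q2 [Q2_0 ->]]]] := F_curve.
by exists Q1, Q2.
Qed.
End Uniformizer.

(** Both sides of x^n - a^n = y^m - b^m factor, and the cofactor of x - a does not
    vanish at the point, so y - b divides x - a. *)
Lemma place_unramified : a != 0 -> exists P : place emb,
  P (y - emb b) = 1 /\ forall f, 0 <= P f -> f != 0 -> exists c, reg f c.
Proof.
move=> a0; pose Sx := \sum_(i < n) x ^+ (n.-1 - i) * emb a ^+ i.
pose Sy := \sum_(i < m) y ^+ (m.-1 - i) * emb b ^+ i.
have Sx_a : reg Sx (a ^+ n.-1) by exact: reg_geometric reg_x.
have Sy_b : reg Sy (b ^+ m.-1) by exact: reg_geometric reg_y.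
have SxSy : (x - emb a) * Sx = (y - emb b) * Sy.
  rewrite /Sx /Sy -!subrXX -!rmorphXn /= ab curve_eq rmorphD rmorph1 /=; ring.
have Sx0 : Sx != 0 by apply: (takes_neq0 val_at_eq0 Sx_a); rewrite expf_neq0.
have yb0 := ev_YsubC_neq0.
have yb_b : reg (y - emb b) 0.
  by have := reg_ev ('X - b%:P)%:P; rewrite ev_YsubC val_atY !hornerE subrr.
apply: (@place_at_uniformizer _ 1 0 1 (b ^+ m.-1 / a ^+ n.-1)) => //.
- by rewrite expr1 mulr1.
- exact: takes1.
- exact: oner_neq0.
have -> : (x - emb a) / (y - emb b) = Sy / Sx.
  by apply/eqP; rewrite eqr_div // SxSy mulrC.
by apply: takesM => //; apply: (takesV val_at_eq0) => //; rewrite expf_neq0.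
Qed.

(** If a = 0 then b is a simple root of y^m + 1, so y - b is x^n up to a unit:
    the projection to the y-line is totally ramified. *)
Lemma ramified_expansion : a = 0 ->
  exists w c, [/\ y - emb b = x ^+ n * w, reg w c & c != 0].
Proof.
move=> a0; pose Sy := \sum_(i < m) y ^+ (m.-1 - i) * emb b ^+ i.
have bm : b ^+ m = 1.
  by apply/eqP; rewrite -subr_eq0 (oppr_pchar2 char2) -ab a0 expr0n gtn_eqF.
have b0 : b != 0.
  by apply: contra_eq_neq bm => ->; rewrite expr0n gtn_eqF // eq_sym oner_eq0.
have Sy_b : reg Sy (b ^+ m.-1) by exact: reg_geometric reg_y.
have Sy0 : Sy != 0 by apply: (takes_neq0 val_at_eq0 Sy_b); rewrite expf_neq0.
have xSy : (y - emb b) * Sy = x ^+ n.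
  by rewrite -subrXX -rmorphXn /= bm rmorph1 curve_eq (oppr_pchar2 Fchar2).
exists Sy^-1, (b ^+ m.-1)^-1; split.
- by rewrite -xSy mulfK.
- by apply: (takesV val_at_eq0) => //; rewrite expf_neq0.
- by rewrite invr_eq0 expf_neq0.
Qed.

Lemma place_ramified : a = 0 -> exists P : place emb,
  P x = 1 /\ forall f, 0 <= P f -> f != 0 -> exists c, reg f c.
Proof.
move=> a0; have [w [c [yE wc c0]]] := ramified_expansion a0.
apply: (@place_at_uniformizer _ w n.-1 c 1) => //.
- exact: x_neq0.
- by have := reg_x; rewrite a0.
- by rewrite prednK.
by rewrite a0 rmorph0 subr0 divff ?x_neq0 //; exact: takes1.
Qed.

(** If a != 0 the uniformizer is y - b, with the same differential as y, and
    be^2 / f is itself regular.  If a = 0 the uniformizer is x, and the relation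
    x^(n-1) dx = y^(m-1) dy turns the regular function (df/dx) / f into
    y^(1-m) x^(n-1) be^2 / f. *)
Lemma log_derivative_regular f al be :
    (forall P : place emb, exists e : int, P f = e + e) ->
    f != 0 -> f = al ^+ 2 + be ^+ 2 * y ->
  exists c, reg (be ^+ 2 / f * x ^+ n.-1) c.
Proof.
move=> f_even f0 fE; have [be0|be0] := eqVneq be 0.
  by exists 0; rewrite be0 expr0n !mul0r; exact: takes0.
have [a0|a0] := eqVneq a 0; last first.
  have [P [Pt Preg]] := place_unramified a0; have [e Pf] := f_even P.
  have [r rb] := closed_sqrt b.
  (* As b = r^2, the term be^2 b can be moved into the first square. *)
  have fE' : f = (al + be * emb r) ^+ 2 + be ^+ 2 * (y - emb b).
    rewrite fE -rb rmorphXn /=; ring: (addrr_pchar2 Fchar2 1).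
  have := even_order_log_derivative Fchar2 f0 fE' Pt Pf.
  move=> /Preg[|c rc]; first by rewrite mulf_neq0 ?expf_neq0 ?invr_eq0.
  by exists (c * a ^+ n.-1); apply: takesM => //; apply: takesX; exact: reg_x.
have [P [Pt Preg]] := place_ramified a0; have [e Pf] := f_even P.
(* The decomposition of f relative to y becomes one relative to x, since
   y = 1/u^2 + (s/u)^2 x. *)
pose u := y ^+ m./2; pose s := x ^+ n./2.
have u0 : u != 0 by rewrite expf_neq0 ?y_neq0.
have s0 : s != 0 by rewrite expf_neq0 ?x_neq0.
have uE : u ^+ 2 = y ^+ m.-1.
  by rewrite -exprM muln2 -[in RHS](odd_double_half m) m_odd.
have sE : s ^+ 2 = x ^+ n.-1.
  by rewrite -exprM muln2 -[in RHS](odd_double_half n) n_odd.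
have sxE : s ^+ 2 * x = u ^+ 2 * y + 1.
  by rewrite sE uE -!exprSr !prednK // curve_eq.
have yE : y = u^-1 ^+ 2 + (s / u) ^+ 2 * x.
  have : u ^+ 2 * y = 1 + s ^+ 2 * x.
    by rewrite sxE addrC -addrA addrr_pchar2 // addr0.
  move=> h; apply: (mulfI (expf_neq0 2 u0)); rewrite h; field; exact: u0.
have fE' : f = (al + be / u) ^+ 2 + (be * (s / u)) ^+ 2 * x.
  by rewrite fE {1}yE; field: (addrr_pchar2 Fchar2 1).
have := even_order_log_derivative Fchar2 f0 fE' Pt Pf.
move=> /Preg[|c rc].
  by rewrite mulf_neq0 ?invr_eq0 // expf_neq0 // !mulf_neq0 ?invr_eq0.
exists (c * b ^+ m.-1).
have -> : be ^+ 2 / f * x ^+ n.-1 = (be * (s / u)) ^+ 2 / f * y ^+ m.-1.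
  by rewrite -uE -sE; field; rewrite f0 u0.
by apply: takesM => //; apply: takesX; exact: reg_y.
Qed.

Definition fiber_poly Q : {poly k} := map_poly (horner_eval b) Q.

Lemma val_at_fiber Q : val_at a b Q = (fiber_poly Q).[a].
Proof.
rewrite /val_at /fiber_poly -[X in _ = _.[X]](hornerC a b).
by rewrite -[LHS]/(horner_eval b _) -horner_map.
Qed.

Lemma val_at_lift (p : {poly k}) : val_at a b p^:P = p.[a].
Proof. by rewrite /val_at horner_map hornerC. Qed.

Lemma coef_fiber Q i : (fiber_poly Q)`_i = (Q`_i).[b].
Proof. by rewrite coef_map. Qed.

End Point.

Lemma divide_by_XsubC Q (b : k) : (forall i, (Q`_i).[b] = 0) ->
  exists2 Q' : {poly {poly k}}, (size Q' <= size Q)%N & Q = ('X - b%:P)%:P * Q'.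
Proof.
move=> Qb; exists (\poly_(i < size Q) (Q`_i %/ ('X - b%:P))); first exact: size_poly.
apply/polyP=> i; rewrite coefCM coef_poly; case: ltnP => [_|/(nth_default 0)->].
  by rewrite mulrC divpK // dvdp_XsubCl; apply/eqP.
by rewrite mulr0.
Qed.

(** At (0, b) the function y - b is divisible by x^n.  Modulo x^n, then, Q equals
    the polynomial in x obtained by setting y = b, whose degree is less than n,
    while Q itself is 0 by hypothesis. *)
Lemma ramified_fiber_eq0 (b : k) Q h c : 0 ^+ n = b ^+ m + 1 -> (size Q <= n)%N ->
  takes ev (val_at 0 b) h c -> ev Q = h * (y - emb b) -> fiber_poly b Q = 0.
Proof.
move=> ab le_Q hc QE; set p := fiber_poly b Q; apply/eqP; apply: contraTT isT => p0.
have [w [c' [yE wc _]]] := ramified_expansion ab erefl.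
have [Q' _ Q'E] : exists2 Q' : {poly {poly k}}, (size Q' <= size (Q - p^:P)%R)%N
    & Q - p^:P = ('X - b%:P)%:P * Q'.
  by apply: divide_by_XsubC => i; rewrite coefB coef_map coef_fiber !hornerE subrr.
have [d pd] : exists d, takes ev (val_at 0 b) (ev p^:P / x ^+ n) d.
  have -> : ev p^:P / x ^+ n = (h - ev Q') * w.
    have -> : p^:P = Q - ('X - b%:P)%:P * Q' by rewrite -Q'E opprB addrC subrK.
    rewrite rmorphB rmorphM /= ev_YsubC QE yE; field.
    by rewrite expf_neq0 ?x_neq0.
  exists ((c - val_at 0 b Q') * c'); apply: takesM => //.
  have := takesD hc (reg_ev 0 b (- Q')); by rewrite !rmorphN.
have [j [q]] := multiplicity_XsubC p 0; rewrite p0 /= => q0 pE.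
have q_nz : q != 0 by apply: contraNneq q0 => ->; rewrite root0.
have lt_jn : (j < n)%N.
  have : (size p <= n)%N by apply: leq_trans le_Q; exact: size_poly.
  rewrite pE size_mul ?expf_neq0 ?polyXsubC_eq0 // size_exp_XsubC addnS /=.
  by apply: leq_trans; rewrite -[X in (X < _)%N]add0n ltn_add2r size_poly_gt0.
have x0 : takes ev (val_at 0 b) x 0 by exact: reg_x.
have := takesM (takesX (n - j) x0) pd.
have -> : x ^+ (n - j) * (ev p^:P / x ^+ n) = ev q^:P.
  rewrite pE rmorphM rmorphXn rmorphM rmorphXn /= map_polyXsubC /= rmorphB /= evX evC.
  rewrite rmorph0 subr0 -[in x ^+ n](subnK (ltnW lt_jn)) exprD; field.
  by rewrite !expf_neq0 ?x_neq0.
move=> /(takes_inj (val_at_eq0 ab)) /(_ (reg_ev _ _ _)).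
rewrite val_at_lift expr0n subn_eq0 leqNgt lt_jn mul0r => /esym/eqP e.
by rewrite /root e in q0.
Qed.

(** The fiber over b consists of n distinct points, and the polynomial has degree
    less than n. *)
Lemma unramified_fiber_eq0 (b : k) Q : b ^+ m + 1 != 0 -> (size Q <= n)%N ->
  (forall a, a ^+ n = b ^+ m + 1 -> val_at a b Q = 0) -> fiber_poly b Q = 0.
Proof.
set d := _ + 1 => d0 le_Q Qa.
have [rs rsE] := closed_field_poly_normal ('X^n - d%:P).
rewrite (monicP (monicXnsubC _ n_gt0)) scale1r in rsE.
have uniq_rs : uniq rs.
  rewrite -separable_prod_XsubC -rsE separable_poly.unlock derivB derivC subr0 derivXn.
  rewrite (mulrn_odd_pchar2 _ _ n_odd) ?pchar_poly //.
  rewrite -[N in coprimep ('X^N - _)](prednK n_gt0) exprS.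
  rewrite coprimep_sym coprimep_addl_mul -polyCN -alg_polyC.
  by rewrite coprimepZr ?oppr_eq0 // coprimep1.
have size_rs : size rs = n.
  by have := congr1 (size \o polyseq) rsE; rewrite /= size_XnsubC // size_prod_XsubC => -[].
apply: contraTeq (leqnn n) => p0; rewrite -ltnNge -{1}size_rs.
have le_p : (size (fiber_poly b Q) <= n)%N by apply: leq_trans le_Q; exact: size_poly.
apply: leq_trans le_p; apply: max_poly_roots => //.
apply/allP => a; rewrite -root_prod_XsubC -rsE /root !hornerE subr_eq0 => /eqP ad.
by rewrite -val_at_fiber Qa.
Qed.

(** Induction on the degree of D in h = Q(x, y) / D(y).  At a root b of D, the
    numerator Q vanishes on the whole fiber over b (to order n if the fiber is
    a single point), hence is divisible by y - b. *)
Lemma regular_is_polynomial h :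
    (forall a b, a ^+ n = b ^+ m + 1 -> exists c, takes ev (val_at a b) h c) ->
  exists2 Q : {poly {poly k}}, (size Q <= n)%N & h = ev Q.
Proof.
move=> h_reg; have [Q [D [D0 le_Q hE]]] := ev_fraction h.
move: {2}(size D) (leqnn (size D)) => e.
elim: e D Q D0 le_Q hE => [|e IH] D Q D0 le_Q hE.
  by rewrite leqn0 size_poly_eq0 (negPf D0).
move=> le_D; have [/eqP D1|D1] := eqVneq (size D) 1%N.
  have /size_poly1P[c c0 DE] := D1; exists (c^-1%:P *: Q).
    exact: leq_trans (size_scale_leq _ _) le_Q.
  rewrite -mul_polyC rmorphM /= -hE DE !evC fmorphV mulrCA mulVf ?mulr1 //.
  by rewrite fmorph_eq0.
have /closed_rootP[b Db] := D1.
have /factor_theorem[D' D'E] := Db.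
have evD : ev D%:P = ev D'%:P * (y - emb b) by rewrite D'E polyCM rmorphM /= ev_YsubC.
have fib0 : fiber_poly b Q = 0.
  have [b0|b0] := eqVneq (b ^+ m + 1) 0; last first.
    apply: unramified_fiber_eq0 => // a ab; have [c hc] := h_reg a b ab.
    have := takesM hc (reg_ev a b D%:P); rewrite hE.
    move=> /(takes_inj (val_at_eq0 ab)) /(_ (reg_ev _ _ _)) <-.
    by rewrite val_atY (eqP Db) mulr0.
  have ab : 0 ^+ n = b ^+ m + 1 by rewrite b0 expr0n gtn_eqF.
  have [c hc] := h_reg 0 b ab.
  apply: (ramified_fiber_eq0 ab le_Q (takesM hc (reg_ev 0 b D'%:P))).
  by rewrite -hE evD mulrA.
have [i|Q' le_Q' QE] := @divide_by_XsubC Q b.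
  by rewrite -coef_fiber fib0 coef0.
have D'0 : D' != 0 by apply: contraNneq D0 => D'0; rewrite D'E D'0 mul0r.
have yb0 : y - emb b != 0 by rewrite ev_YsubC_neq0.
apply: (IH D' Q' D'0).
- exact: leq_trans le_Q.
- apply: (mulIf yb0); rewrite -mulrA -evD hE QE rmorphM /= ev_YsubC mulrC //.
by move: le_D; rewrite D'E size_Mmonic ?monicXsubC // size_XsubC addn2.
Qed.


(** The set F^2 + F^2 y is a ring.  It contains the constants, as they are
    squares, and y; it contains x because n is odd, so that x is the product of
    x^n = y^m + 1 and a square. *)
Lemma square_decomposition f : exists al be, f = al ^+ 2 + be ^+ 2 * y.
Proof.
pose S f := exists al be, f = al ^+ 2 + be ^+ 2 * y.
have SD f1 f2 : S f1 -> S f2 -> S (f1 + f2).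
  move=> [a1 [b1 ->]] [a2 [b2 ->]]; exists (a1 + a2), (b1 + b2).
  by ring: (addrr_pchar2 Fchar2 1).
have SM f1 f2 : S f1 -> S f2 -> S (f1 * f2).
  move=> [a1 [b1 ->]] [a2 [b2 ->]].
  (* The minus sign makes the cross terms cancel. *)
  exists (a1 * a2 + b1 * b2 * y), (a1 * b2 - a2 * b1).
  by ring.
have S2 f1 : S (f1 ^+ 2) by exists f1, 0; ring.
have Sy : S y by exists 0, 1; ring.
have SC c : S (emb c) by have [r <-] := closed_sqrt c; rewrite rmorphXn.
have Sx : S x.
  have -> : x = (y ^+ m + 1) * (x ^- n./2) ^+ 2.
    by rewrite -curve_eq (expr_odd _ n_odd); field; rewrite expf_neq0 // x_neq0.
  apply: (SM) => //; rewrite (expr_odd _ m_odd).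
  apply: (SD); last by rewrite -[1](rmorph1 emb).
  exact: (SM).
have Sev Q : S (ev Q).
  elim/poly_ind: Q => [|Q p IH]; first by rewrite rmorph0 -[0](rmorph0 emb).
  rewrite rmorphD rmorphM /= evX; apply: (SD); first exact: (SM).
  elim/poly_ind: p => [|p c IHp]; first by rewrite polyC0 rmorph0 -[0](rmorph0 emb).
  rewrite polyCD polyCM rmorphD rmorphM /= evC; apply: (SD) => //; apply: (SM) => //.
  by rewrite evY map_polyX hornerX.
have [_ /(_ f)[Q1 [Q2 [Q2_0 ->]]]] := F_curve.
have -> : eval2 emb Q1 x y / eval2 emb Q2 x y = ev Q1 * ev Q2 * (ev Q2)^-1 ^+ 2.
  by rewrite /ev; field.
by apply: (SM) => //; apply: (SM).
Qed.

(** Negative powers of x make the Cartier operator double exponents without a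
    shift. *)
Lemma ev_sum_inv Q : (size Q <= n)%N ->
  ev Q = x ^+ n.-1 * \sum_(j < n) ev (Q`_(n.-1 - j))%:P * x ^- j.
Proof.
move=> le_Q; have QE : Q = \sum_(i < n) (Q`_i)%:P * 'X^i.
  apply/polyP => i; rewrite coef_sum.
  have [lt_i|ge_i] := ltnP i n; last first.
    rewrite nth_default ?(leq_trans le_Q) // big1 // => j _.
    by rewrite coefCM coefXn gtn_eqF ?mulr0 // (leq_trans (ltn_ord j)).
  rewrite (bigD1 (Ordinal lt_i)) //= big1 ?addr0 => [|j ne_j].
    by rewrite coefCM coefXn eqxx mulr1.
  rewrite coefCM coefXn; move: ne_j; rewrite -val_eqE eq_sym /= => /negPf ->.
  by rewrite mulr0.
rewrite {1}QE rmorph_sum mulr_sumr (reindex_inj rev_ord_inj) /=.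
apply: eq_bigr => j _; rewrite rmorphM rmorphXn /= evX mulrCA.
have le_j : (j <= n.-1)%N by rewrite -ltnS prednK.
have -> : (n - j.+1 = n.-1 - j)%N by rewrite subnS -subn1 -[in RHS]subn1 subnAC.
by rewrite -[in x ^+ n.-1](subnK le_j) exprD mulfK // expf_neq0 ?x_neq0.
Qed.

Lemma inv_powers_free (c : 'I_n -> {poly k}) :
  \sum_j ev (c j)%:P * x ^- j = 0 -> forall j, c j = 0.
Proof.
move=> c0; pose Q := \poly_(i < n) c (insubd (Ordinal n_gt0) (n.-1 - i)%N).
have lej (j : 'I_n) : (j <= n.-1)%N by rewrite -ltnS prednK.
have QE (j : 'I_n) : Q`_(n.-1 - j) = c j.
  rewrite coef_poly (leq_ltn_trans (leq_subr _ _)) ?prednK //.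
  by congr c; apply/val_inj; rewrite subKn // val_insubd ltn_ord.
have Q0 : Q = 0.
  apply: ev_inj; first exact: size_poly.
  rewrite ev_sum_inv ?size_poly //.
  rewrite (eq_bigr (fun j => ev (c j)%:P * x ^- j)) ?c0 ?mulr0 //.
  by move=> j _; rewrite QE.
by move=> j; rewrite -QE Q0 coef0.
Qed.

Let dbl := @dbl_ord n n_gt0.
(** The correction in x^-(2j mod n) = wt_j(y) x^-(2j). *)
Let wt (j : 'I_n) : {poly k} := if (2 * j < n)%N then 1 else 'X^m + 1.

Let ev_w : ev ('X^m + 1)%:P = x ^+ n.
Proof. by rewrite evY rmorphD rmorphXn rmorph1 /= map_polyX !hornerE curve_eq. Qed.

Lemma inv_power_dbl (j : 'I_n) : x ^- (dbl j) = ev (wt j)%:P * x ^- (2 * j).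
Proof.
rewrite /wt /=; case: ltnP => [lt_j|ge_j].
  by rewrite modn_small // rmorph1 mul1r.
rewrite ev_w -(subnK ge_j) modnDr modn_small; last by have := ltn_ord j; lia.
rewrite exprD; field.
by rewrite !expf_neq0 ?x_neq0.
Qed.

Lemma inv_even_powers_free (c : 'I_n -> {poly k}) :
  \sum_j ev (c j)%:P * x ^- (2 * j) = 0 -> forall j, c j = 0.
Proof.
move=> c0; have [g gK Kg] := dbl_ord_bij n_gt0 n_odd.
(* Multiplying by x^n clears the denominators: wt' j * wt j = y^m + 1. *)
pose wt' (j : 'I_n) : {poly k} := if (2 * j < n)%N then 'X^m + 1 else 1.
have wtE j : ev (wt' j)%:P * x ^- (dbl j) = x ^+ n * x ^- (2 * j).
  by rewrite inv_power_dbl /wt /wt'; case: ifP => _; rewrite ?rmorph1 ?ev_w; ring.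
have wt'0 j : wt' j != 0.
  rewrite /wt'; case: ifP => _; last exact: oner_neq0.
  by rewrite -[1]opprK -size_poly_eq0 -polyCN size_XnsubC.
have /inv_powers_free h : \sum_j ev (c (g j) * wt' (g j))%:P * x ^- j = 0.
  rewrite (reindex dbl) /=; last by exists g => ? _; [apply: gK|apply: Kg].
  rewrite -[RHS](mulr0 (x ^+ n)) -[in RHS]c0 mulr_sumr; apply: eq_bigr => j _.
  by rewrite gK polyCM rmorphM /= -mulrA wtE mulrCA.
move=> j; have /eqP := h (dbl j); rewrite gK mulf_eq0 (negPf (wt'0 j)) orbF.
by move/eqP.
Qed.

Lemma evYB (p q : {poly k}) : ev (p - q)%:P = ev p%:P - ev q%:P.
Proof. by rewrite polyCB rmorphB. Qed.

(** Expand both sides on the basis of the x^-(2j), j < n, over k(y).  The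
    denominator D of A enters only through D^2, a constant for the derivation in
    characteristic two, as are the squares coming from A^2. *)
Lemma cartier_fixed_coefficients Q (A : F) : (size Q <= n)%N ->
    ev Q / x ^+ n.-1 = A ^+ 2 + y * (ev Q / x ^+ n.-1) ^+ 2 ->
  forall j : 'I_n, (wt j * Q`_(n.-1 - dbl j))^`() = Q`_(n.-1 - j) ^+ 2.
Proof.
move=> le_Q; have x_n : x ^+ n.-1 != 0 by rewrite expf_neq0 ?x_neq0.
have [R [D [D0 le_R AE]]] := ev_fraction (A * x ^+ n.-1).
rewrite ev_sum_inv // mulrC mulKf // => gE.
have {}AE : A * ev D%:P = \sum_(j < n) ev (R`_(n.-1 - j))%:P * x ^- j.
  by apply: (mulfI x_n); rewrite -ev_sum_inv // -AE; ring.
have yE : y = ev 'X%:P by rewrite evY map_polyX hornerX.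
have key j : D ^+ 2 * (wt j * Q`_(n.-1 - dbl j)) - R`_(n.-1 - j) ^+ 2
               - 'X * D ^+ 2 * Q`_(n.-1 - j) ^+ 2 = 0.
  move: j; apply: inv_even_powers_free.
  set g := \sum_(j < n) _ in gE.
  have e1 : ev (D ^+ 2)%:P * g =
      \sum_(j < n) ev (D ^+ 2 * (wt j * Q`_(n.-1 - dbl j)))%:P * x ^- (2 * j).
    rewrite /g (reindex dbl) /=; last exact/onW_bij/dbl_ord_bij.
    rewrite mulr_sumr; apply: eq_bigr => j _.
    by rewrite inv_power_dbl !polyCM !rmorphM /=; ring.
  have sq (c : 'I_n -> {poly k}) : (\sum_j ev (c j)%:P * x ^- j) ^+ 2 =
      \sum_j ev (c j ^+ 2)%:P * x ^- (2 * j).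
    rewrite sqr_sum_pchar2 //; apply: eq_bigr => j _.
    by rewrite exprMn polyC_exp rmorphXn /= exprVn -exprM mulnC.
  have e2 : (A * ev D%:P) ^+ 2 =
      \sum_(j < n) ev (R`_(n.-1 - j) ^+ 2)%:P * x ^- (2 * j).
    by rewrite AE sq.
  have e3 : ev ('X * D ^+ 2)%:P * g ^+ 2
      = \sum_(j < n) ev ('X * D ^+ 2 * Q`_(n.-1 - j) ^+ 2)%:P * x ^- (2 * j).
    rewrite /g sq mulr_sumr; apply: eq_bigr => j _.
    by rewrite [in RHS]polyCM [in RHS]rmorphM /= mulrA.
  rewrite (eq_bigr (fun j : 'I_n =>
     ev (D ^+ 2 * (wt j * Q`_(n.-1 - dbl j)))%:P * x ^- (2 * j)
     - ev (R`_(n.-1 - j) ^+ 2)%:P * x ^- (2 * j)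
     - ev ('X * D ^+ 2 * Q`_(n.-1 - j) ^+ 2)%:P * x ^- (2 * j))); last first.
    by move=> j _; rewrite !evYB !mulrBl.
  have eD : ev (D ^+ 2)%:P = ev D%:P ^+ 2 by rewrite polyC_exp rmorphXn.
  have eXD : ev ('X * D ^+ 2)%:P = y * ev D%:P ^+ 2.
    by rewrite polyCM rmorphM /= eD -yE.
  by rewrite !sumrB -e1 -e2 -e3 {1}gE eD eXD; ring.
move=> j; have D20 : D ^+ 2 != 0 by rewrite expf_neq0.
have dM p : (D ^+ 2 * p)^`() = D ^+ 2 * p^`().
  by rewrite derivM deriv_sqr_pchar2 // mul0r add0r.
have dX q : ('X * D ^+ 2 * q ^+ 2)^`() = D ^+ 2 * q ^+ 2.
  by rewrite -mulrA -exprMn derivM derivX mul1r deriv_sqr_pchar2 // mulr0 addr0.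
apply: (mulfI D20); apply/eqP; rewrite -subr_eq0; apply/eqP.
have := congr1 deriv (key j).
by rewrite !derivB dM deriv_sqr_pchar2 // subr0 dX deriv0.
Qed.

(** The recursion on coefficients is read at even exponents: the coefficient of
    y^(2(i-1)) in s_j^2 is the square of that of y^(i-1) in s_j. *)
Lemma even_order_square (u v : nat) f :
    unit_order 2 m u -> unit_order 2 n v -> gcdn u v = 1%N ->
    (forall P : place emb, exists e : int, P f = e + e) -> f != 0 ->
  exists al, f = al ^+ 2.
Proof.
move=> u_ord v_ord uv1 f_even f0.
have [al [be fE]] := square_decomposition f.
have x_n : x ^+ n.-1 != 0 by rewrite expf_neq0 ?x_neq0.
have [Q le_Q QE] : exists2 Q : {poly {poly k}},
    (size Q <= n)%N & be ^+ 2 / f * x ^+ n.-1 = ev Q.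
  by apply: regular_is_polynomial => a b ab; exact: log_derivative_regular fE.
have gE : ev Q / x ^+ n.-1 = (al * be / f) ^+ 2 + y * (ev Q / x ^+ n.-1) ^+ 2.
  rewrite -QE mulfK //; transitivity (be ^+ 2 * f / f ^+ 2); first by field.
  by rewrite {1}fE; field.
have rec := cartier_fixed_coefficients le_Q gE.
(* N i j says that y^(i-1) x^-j occurs in g. *)
pose N i j := [/\ (0 < i)%N, (j < n)%N & (Q`_(n.-1 - j))`_i.-1 != 0].
have N0 : forall i j, ~ N i j.
  pose B := (\max_(i < n) size (Q`_i)%R)%N.
  apply: (doubling_support_empty (B := B) m_odd n_odd u_ord v_ord uv1).
    move=> i j [i_gt0 lt_j Nij]; rewrite i_gt0 lt_j andbT /=.
    have lt_nj : (n.-1 - j < n)%N by rewrite (leq_ltn_trans (leq_subr _ _)) ?prednK.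
    apply: leq_trans (leq_bigmax (Ordinal lt_nj)); rewrite /= -(prednK i_gt0).
    by rewrite ltnNge; apply: contra Nij => /(nth_default 0) ->.
  move=> i j [i_gt0 lt_j Nij].
  have := congr1 (fun p : {poly k} => p`_(i.-1.*2)) (rec (Ordinal lt_j)).
  rewrite coef_sqr_pchar2 //= coef_deriv mulrn_odd_pchar2 //=; last by rewrite odd_double.
  have -> : (i.-1.*2.+1 = (2 * i).-1)%N by lia.
  rewrite /wt /=; case: ltnP => [lt_2j|ge_2j].
    rewrite mul1r modn_small // => e; split; rewrite ?muln_gt0 ?i_gt0 //.
    by rewrite e expf_neq0.
  have -> : ((2 * j) %% n = 2 * j - n)%N.
    by rewrite -[in LHS](subnK ge_2j) modnDr modn_small //; lia.
  rewrite mulrDl mul1r coefD coefXnM => e.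
  have lt_2jn : (2 * j - n < n)%N by lia.
  have [z|nz] := eqVneq ((Q`_(n.-1 - (2 * j - n)))`_(2 * i).-1) 0; last first.
    by left; split=> //; rewrite muln_gt0.
  right; move: e; rewrite z addr0; case: ltnP => [_ e|le_m e].
    by case/eqP: (expf_neq0 2 Nij); rewrite -e.
  split=> //; first by lia.
  have -> : ((2 * i - m).-1 = (2 * i).-1 - m)%N by lia.
  by rewrite e expf_neq0.
have Q0 : Q = 0.
  apply/polyP => i; rewrite coef0; have [lt_i|ge_i] := ltnP i n; last first.
    by rewrite nth_default // (leq_trans le_Q).
  apply/polyP => l; rewrite coef0; apply/eqP/negPn/negP => nz.
  apply: (N0 l.+1 (n.-1 - i)%N); split=> //=.
    by rewrite (leq_ltn_trans (leq_subr _ _)) ?prednK.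
  by rewrite subKn // -ltnS prednK.
have be0 : be = 0.
  apply/eqP; have /eqP := QE.
  rewrite Q0 rmorph0 !mulf_eq0 invr_eq0 (negPf f0) (negPf x_n) !orbF.
  by rewrite orbb.
by exists al; rewrite fE be0 expr0n mul0r addr0.
Qed.

End Curve.

(** * The two-torsion of the Jacobian *)

Section TwoTorsion.
Local Open Scope quotient_scope.

Lemma Pic_class_eq0 (k F : fieldType) (emb : {rmorphism k -> F})
    (D : divisor emb) :
  (\pi_({ideal_quot (principal (emb := emb))}) D = 0 :> Pic emb) <->
  exists f, is_div_of D f.
Proof.
rewrite -(raddf0 (\pi_({ideal_quot (principal (emb := emb))}))).
split=> [/eqP|[f Df]]; last apply/eqP; rewrite -Quotient.idealrBE subr0.
  by move/asboolP.
by apply/asboolP; exists f.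
Qed.

Lemma has_prank0 (k F : fieldType) (emb : {rmorphism k -> F}) (p : nat) :
  (forall c : Pic emb, in_Jac c -> c *+ p = 0 -> c = 0) -> has_prank emb p 0.
Proof.
move=> no_torsion; exists (\0); split=> [w w' _|c].
  by rewrite [w]thinmx0 [w']thinmx0.
split=> [[Jc pc]|[w ->]]; first by exists 0; exact: no_torsion.
rewrite mul0rn; split=> //; exists 0; first by rewrite deg0.
by rewrite raddf0.
Qed.

End TwoTorsion.

Theorem corollary4p7 (k : closedFieldType) (iota : {rmorphism 'F_2 -> k})
    (k_algebraic : integralRange iota)
    (F : fieldType) (emb : {rmorphism k -> F}) (x y : F)
    (n m u v : nat) (n_odd : odd n) (m_odd : odd m)
    (u_order : unit_order 2 m u) (v_order : unit_order 2 n v)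
    (uv_coprime : gcdn u v = 1%N)
    (F_curve : function_field_of emb ('Y ^+ m - ('X ^+ n + 1)) x y) :
  has_prank emb 2 0.
Proof.
have char2 : 2 \in [pchar k] by rewrite (fmorph_pchar iota) pchar_Fp.
apply: has_prank0 => _ [D _ ->].
rewrite -raddfMn => /Pic_class_eq0[f [f0 Df]]; apply/Pic_class_eq0.
have f_even (P : place emb) : P f = coeff P D + coeff P D.
  by rewrite -Df raddfMn mulr2n.
have [|al fE] := even_order_square n_odd m_odd char2 F_curve
  u_order v_order uv_coprime _ f0.
  by move=> P; exists (coeff P D); exact: f_even.
have al0 : al != 0 by apply: contraNneq f0 => al0; rewrite fE al0 expr0n.
exists al; split=> // P; have := f_even P; rewrite fE ordX2 //; lia.
Qed.
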